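(* Let $q\ge1$, let $q_\star$ be the conjugate index ($1/q+1/q_\star=1$), let $x_1,\dots,x_n\in\mathbb{R}^p$, $y_1,\dots,y_n\in\{\pm1\}$, and let $X\in\mathbb{R}^{n\times p}$ have rows $x_i^\top$. Assume that $|X_{ij}|\le M$ for all $i\in[n],j\in[p]$ and that $\kappa_{n,\ell_q}:=\max_{\|\theta\|_q\le1}\min_{1\le i\le n}y_ix_i^\top\theta>0$. Let $0<\epsilon<1$, and run the AdaBoost variant corresponding to $\ell_q$ geometry (see context) with learning rate $\alpha_t(\beta)=\beta\cdot\eta_t^\top Zv_{t+1}$, where $\beta<1$ and the shrinkage factor is chosen as $\beta=\dfrac{\epsilon}{p^{2/q_\star}M^2}$. If $$T\ge\log(1.01\,ne)\cdot\frac{2p^{2/q_\star}M^2\epsilon^{-2}}{\kappa_{n,\ell_q}^2},$$ then after $T$ iterations the iterate $\theta_T$ satisfies $$\kappa_{n,\ell_q}\ \ge\ \min_{i\in[n]}\frac{y_ix_i^\top\theta_T}{\|\theta_T\|_q}\ >\ \kappa_{n,\ell_q}\cdot(1-\epsilon).$$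
   Context: **AdaBoost variant corresponding to $\ell_q$ geometry.** Let $Z\in\mathbb{R}^{n\times p}$ have rows $y_ix_i^\top$ and let $\Delta_n$ be the probability simplex in $\mathbb{R}^n$. Initialize $\eta_0=\frac1n\mathbf{1}_n\in\Delta_n$, $\theta_0=0\in\mathbb{R}^p$. At time $t\ge0$: (a) update direction $v_{t+1}\in\arg\max_{v\in\mathbb{R}^p,\|v\|_q=1}\langle Z^\top\eta_t,v\rangle$; (b) step size $\alpha_t=\alpha_t(\beta)=\beta\cdot\|Z^\top\eta_t\|_{q_\star}=\beta\,\eta_t^\top Zv_{t+1}$, with $0<\beta<1$ a shrinkage factor; (c) $\theta_{t+1}=\theta_t+\alpha_tv_{t+1}$; (d) $\eta_{t+1}[i]\propto\eta_t[i]\exp(-\alpha_ty_ix_i^\top v_{t+1})$, normalized so that $\eta_{t+1}\in\Delta_n$. Terminate after $T$ steps and output $\theta_T$. For $q=1$, $q_\star=\infty$ and $p^{2/q_\star}=1$. *)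

(* Defs.v *)
From mathcomp Require Import all_boot all_order all_algebra.
From mathcomp Require Import all_classical all_reals all_analysis.

Set Implicit Arguments.
Unset Strict Implicit.
Unset Printing Implicit Defensive.

Import Order.TTheory GRing.Theory Num.Theory.

Local Open Scope classical_set_scope.
Local Open Scope ring_scope.

Definition argmax (R : realType) (A : Type) (D : set A) (f : A -> R) : set A :=
  [set a | D a /\ forall b, D b -> f b <= f a].

Definition is_max (R : realType) (A : Type) (D : set A) (f : A -> R) (m : R) :
  Prop := exists2 a, argmax D f a & m = f a.

Definition min_ord (R : realType) (n : nat) (F : 'I_n.+1 -> R) : R :=
  \big[Num.min/F ord0]_(i < n.+1) F i.

Definition inner (R : realType) (p : nat) (u v : 'cV[R]_p) : R :=
  \sum_(j < p) u j 0 * v j 0.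

Definition lqnorm (R : realType) (p : nat) (q : R) (v : 'cV[R]_p) : R :=
  (\sum_(j < p) `|v j 0| `^ q) `^ q^-1.

(* The rows of [X] are the x_i^T; those of [signed_data y X] are y_i x_i^T. *)
Definition signed_data (R : realType) (n p : nat) (y : 'I_n -> R)
    (X : 'M[R]_(n, p)) : 'M[R]_(n, p) :=
  \matrix_(i < n, j < p) (y i * X i j).

Definition is_lq_margin (R : realType) (n p : nat) (q : R) (y : 'I_n.+1 -> R)
    (X : 'M[R]_(n.+1, p)) (kappa : R) : Prop :=
  is_max [set theta : 'cV[R]_p | lqnorm q theta <= 1]
    (fun theta => min_ord (fun i => y i * (X *m theta) i 0)) kappa.

(* alpha_t = beta * eta_t^T Z v_{t+1}; since v_{t+1} is a maximizer, this is
   also beta times the dual norm of Z^T eta_t. *)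
Definition step_size (R : realType) (n p : nat) (beta : R) (Z : 'M[R]_(n, p))
    (eta : 'cV[R]_n) (v : 'cV[R]_p) : R :=
  beta * inner eta (Z *m v).

(* A run of [T] steps. The maximizer v_{t+1} need not be unique, so a run is a
   relation; [v 0] and all values at times beyond [T] are irrelevant. *)
Record adaboost_run (R : realType) (n p : nat) (q beta : R) (Z : 'M[R]_(n, p))
    (T : nat) (eta : nat -> 'cV[R]_n) (theta v : nat -> 'cV[R]_p) : Prop := {
  run_eta0 : eta 0%N = const_mx (n%:R^-1);
  run_theta0 : theta 0%N = 0;
  run_direction : forall t, (t < T)%N ->
    argmax [set u : 'cV[R]_p | lqnorm q u = 1] (inner (Z^T *m eta t)) (v t.+1);
  run_theta : forall t, (t < T)%N ->
    theta t.+1 = theta t + step_size beta Z (eta t) (v t.+1) *: v t.+1;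
  run_eta : forall t, (t < T)%N ->
    let w i := eta t i 0 *
      expR (- step_size beta Z (eta t) (v t.+1) * (Z *m v t.+1) i 0) in
    eta t.+1 = \col_(i < n) (w i / \sum_(j < n) w j)
}.

(* Main.v *)
Require Import Defs.
From mathcomp Require Import all_boot all_order all_algebra.
From mathcomp Require Import all_classical all_reals all_analysis.
From mathcomp Require Import ring lra.

Set Implicit Arguments.
Unset Strict Implicit.
Unset Printing Implicit Defensive.

Import Order.TTheory GRing.Theory Num.Theory.
Import numFieldNormedType.Exports.

Local Open Scope ring_scope.

(** The argument plays a potential against a norm.

    Write [Z] for the signed data matrix, [g_t = eta_t^T Z v_(t+1)] for the edge
    at time [t], and [L = p^(1/qstar) M], where [1/qstar = 1 - 1/q]. Every edge
    is at least [kappa]: the maximal edge dominates the edge of the max-margin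
    direction, which is an [eta_t]-average of margins, each at least [kappa]
    ([margin_le_edge]).

    By Hoelder's inequality the margins of a unit vector lie in [[-L, L]]
    ([margin_le_lqnorm]), so Hoeffding's lemma ([weighted_hoeffding]) bounds the
    normalization constant of the weight update by
    [exp(- alpha_t g_t + alpha_t^2 L^2 / 2)], which is
    [exp(- beta (1 - beta L^2 / 2) g_t^2)] since [alpha_t = beta g_t]. The
    product of these constants controls [exp(- (Z theta_T)_i) / n], whence every
    margin of [theta_T] is at least
    [beta (1 - beta L^2 / 2) sum_t g_t^2 - ln n]. On the other hand the triangle
    inequality gives [||theta_T||_q <= beta sum_t g_t]
    ([adaboost_invariant] carries both facts along the run).

    With [beta = eps / L^2] one has [beta L^2 / 2 = eps / 2]. Using
    [sum_t g_t^2 >= kappa sum_t g_t] and [sum_t g_t >= T kappa], the margins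
    exceed [kappa (1 - eps) ||theta_T||_q] by at least
    [beta kappa^2 T eps / 2 - ln n], and the assumption on [T] makes this
    positive. The upper bound on the normalized margin holds because
    [theta_T / ||theta_T||_q] competes in the definition of [kappa]. *)

(** * Hoeffding's lemma for finite weighted averages *)

Lemma le_of_derive_ge0 (R : realType) (f df : R -> R) (s : R) :
  (forall x, is_derive x (1 : R) f (df x)) -> (forall x, 0 <= x -> 0 <= df x) ->
  0 <= s -> f 0 <= f s.
Proof.
move=> fdf df_ge0 s_ge0.
have cf : {within `[0, s], continuous f}%classic.
  apply: continuous_subspaceT => x; apply: differentiable_continuous.
  by apply/derivable1_diffP; have [] := fdf x.
have [c /[!in_itv]/= /andP[c_ge0 _]] := MVT_segment s_ge0 (fun x _ => fdf x) cf.
by rewrite -[f 0 <= _]subr_ge0 => ->; rewrite subr0 mulr_ge0// df_ge0.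
Qed.

(** The moment generating function bound for the law on [{-1, 1}] with mean
    [u], evaluated at [- s]. If [D s] is the left-hand side, then
    [r = D' / D] satisfies [r' = 1 - r ^ 2 <= 1], since [D'' = D]. Hence
    [psi = s - u - r s], which vanishes at [0], is nonnegative for [s >= 0], and
    [psi] is the logarithmic derivative of the quotient of the two sides. *)
Lemma two_point_mgf (R : realType) (u s : R) : -1 <= u <= 1 -> 0 <= s ->
  (1 - u) / 2 * expR s + (1 + u) / 2 * expR (- s)
    <= expR (- (u * s) + s ^+ 2 / 2).
Proof.
move=> /andP[u_ge u_le] s_ge0.
pose D x : R := (1 - u) / 2 * expR x + (1 + u) / 2 * expR (- x).
pose D' x : R := (1 - u) / 2 * expR x - (1 + u) / 2 * expR (- x).
have D_gt0 x : 0 < D x.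
  rewrite /D; have := expR_gt0 x; have := expR_gt0 (- x).
  (* For u = 1 the first coefficient vanishes and the second carries D. *)
  have [->|u_neq1] := eqVneq u 1; first by lra.
  have u_lt1 : u < 1 by rewrite lt_neqAle u_neq1.
  move=> e1 e2; apply: ltr_wpDr; last by apply: mulr_gt0 => //; lra.
  by apply: mulr_ge0; [lra | exact: ltW].
have dD x : is_derive x (1 : R) D (D' x).
  by apply: is_derive_eq; rewrite /D' /GRing.scale/=; ring.
have dD' x : is_derive x (1 : R) D' (D x).
  by apply: is_derive_eq; rewrite /D /GRing.scale/=; ring.
pose psi x : R := x - u - D' x * (D x)^-1.
have psi_ge0 x : 0 <= x -> 0 <= psi x.
  move=> x_ge0; have <- : psi 0 = 0.
    by rewrite /psi /D /D' oppr0 expR0; field; lra.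
  apply: (@le_of_derive_ge0 _ psi (fun y => (D' y / D y) ^+ 2)) => [y|y _|//].
    have Dy : D y != 0 by rewrite gt_eqF.
    have dV := is_deriveV Dy (dD y).
    apply: is_derive_eq; rewrite /GRing.scale/=.
    by field.
  exact: sqr_ge0.
pose F x : R := - (expR (u * x - x ^+ 2 / 2) * D x).
have : F 0 <= F s.
  apply: (@le_of_derive_ge0 _ F
    (fun x => expR (u * x - x ^+ 2 / 2) * D x * psi x)) => [x|x|//].
    apply: is_derive_eq; rewrite /GRing.scale/= /psi.
    by field; rewrite gt_eqF.
  by move=> x_ge0; rewrite !mulr_ge0 ?expR_ge0 ?psi_ge0// ltW.
rewrite /F lerN2 {2}/D mulr0 expr0n/= mul0r subr0 oppr0 expR0 !mulr1.
rewrite -[leRHS]/_ (_ : _ / 2 + _ / 2 = 1 :> R); last by field.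
move=> F_le1; rewrite -(ler_pM2l (expR_gt0 (u * s - s ^+ 2 / 2))).
apply: le_trans F_le1 _.
by rewrite -expRD [X in expR X](_ : _ = 0) ?expR0//; ring.
Qed.

(** Convexity places [exp] below its chord over [[- a L, a L]]; averaging the
    chord values leaves a two-point law with the same mean. *)
Lemma weighted_hoeffding (R : realType) (n : nat) (w x : 'I_n -> R) (L a : R) :
  (forall i, 0 <= w i) -> \sum_i w i = 1 ->
  0 < L -> (forall i, `|x i| <= L) -> 0 <= a ->
  \sum_i w i * expR (- a * x i)
    <= expR (- a * (\sum_i w i * x i) + a ^+ 2 * L ^+ 2 / 2).
Proof.
move=> w_ge0 w_sum1 L_gt0 xL a_ge0.
have L_neq0 : L != 0 by rewrite gt_eqF.
set mu := \sum_i w i * x i.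
have chord i : expR (- a * x i) <=
    (1 - x i / L) / 2 * expR (a * L) + (1 + x i / L) / 2 * expR (- (a * L)).
  have /andP[xl xu] : -1 <= x i / L <= 1.
    by rewrite ler_pdivlMr// ler_pdivrMr// mulN1r mul1r -ler_norml.
  have t0 : 0 <= (1 - x i / L) / 2 by lra.
  have t1 : (1 - x i / L) / 2 <= 1 by lra.
  have := convex_expR (Itv01 t0 t1) (a * L) (- (a * L)).
  rewrite !convRE /= /unstable.onem.
  rewrite [X in expR X <= _](_ : _ = - a * x i); last by field.
  by rewrite (_ : 1 - (1 - x i / L) / 2 = (1 + x i / L) / 2)//; field.
have mu_ub : \sum_i w i * L = L by rewrite -mulr_suml w_sum1 mul1r.
have muL : `|mu| <= L.
  rewrite -mu_ub; apply: le_trans (ler_norm_sum _ _ _) _.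
  by apply: ler_sum => i _; rewrite normrM (ger0_norm (w_ge0 i)) ler_wpM2l.
apply: le_trans (_ : (1 - mu / L) / 2 * expR (a * L)
    + (1 + mu / L) / 2 * expR (- (a * L)) <= _).
  apply: le_trans (ler_sum _ (fun i _ => ler_wpM2l (w_ge0 i) (chord i))) _.
  have split1 i : w i * ((1 - x i / L) / 2 * expR (a * L) +
      (1 + x i / L) / 2 * expR (- (a * L))) =
    w i * ((expR (a * L) + expR (- (a * L))) / 2) +
    w i * x i * ((expR (- (a * L)) - expR (a * L)) / 2 / L) by field.
  under eq_bigr do rewrite split1.
  rewrite big_split/= -!mulr_suml w_sum1 -/mu le_eqVlt; apply/orP; left.
  by apply/eqP; field.
have /andP[ml mu'] : -1 <= mu / L <= 1.
  by rewrite ler_pdivlMr// ler_pdivrMr// mulN1r mul1r -ler_norml.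
apply: le_trans (two_point_mgf _ _) _; rewrite ?ml ?mulr_ge0 ?(ltW L_gt0)//.
rewrite le_eqVlt; apply/orP; left; apply/eqP; congr expR.
by field.
Qed.

(** * The l_q norm *)

Lemma lqnorm_ge0 (R : realType) (p : nat) (q : R) (v : 'cV[R]_p) :
  0 <= lqnorm q v.
Proof. exact: powR_ge0. Qed.

Lemma lqnorm_powR (R : realType) (p : nat) (q : R) (v : 'cV[R]_p) : q != 0 ->
  lqnorm q v `^ q = \sum_j `|v j 0| `^ q.
Proof.
move=> q_neq0; rewrite /lqnorm -powRrM mulVf// powRr1//.
by apply: sumr_ge0 => j _; exact: powR_ge0.
Qed.

Lemma lqnorm_le (R : realType) (p : nat) (q c : R) (v : 'cV[R]_p) :
  0 < q -> 0 <= c -> \sum_j `|v j 0| `^ q <= c `^ q -> lqnorm q v <= c.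
Proof.
move=> q_gt0 c_ge0 vc.
rewrite [leRHS](_ : c = (c `^ q) `^ q^-1); last first.
  by rewrite -powRrM mulfV ?gt_eqF// powRr1.
rewrite ge0_ler_powR ?nnegrE ?invr_ge0 ?powR_ge0 ?(ltW q_gt0)//.
by apply: sumr_ge0 => j _; exact: powR_ge0.
Qed.

Lemma lqnormZ (R : realType) (p : nat) (q a : R) (v : 'cV[R]_p) : 0 < q ->
  lqnorm q (a *: v) = `|a| * lqnorm q v.
Proof.
move=> q_gt0; rewrite /lqnorm.
under eq_bigr do rewrite mxE normrM powRM//.
rewrite -mulr_sumr powRM ?powR_ge0//.
  by rewrite -powRrM mulfV ?gt_eqF// powRr1.
by apply: sumr_ge0 => j _; exact: powR_ge0.
Qed.

Lemma lqnorm0 (R : realType) (p : nat) (q : R) : 0 < q ->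
  lqnorm q (0 : 'cV[R]_p) = 0.
Proof.
by move=> q_gt0; rewrite -[X in lqnorm q X](scale0r 0) lqnormZ// normr0 mul0r.
Qed.

Lemma lqnorm_eq0 (R : realType) (p : nat) (q : R) (v : 'cV[R]_p) : 0 < q ->
  lqnorm q v = 0 -> v = 0.
Proof.
move=> q_gt0 v0; have q_neq0 : q != 0 by rewrite gt_eqF.
have /esym/eqP := lqnorm_powR v q_neq0.
rewrite v0 powR0// psumr_eq0 => [/allP vj0|j _]; last exact: powR_ge0.
apply/colP => j; rewrite mxE.
have := vj0 j (mem_index_enum _).
by rewrite /= powR_eq0 q_neq0 andbT normr_eq0 => /eqP.
Qed.

(** Inside the unit ball no [q]-th root is needed, so this is coordinatewise
    convexity of [x ^ q]. *)
Lemma lqnorm_convex (R : realType) (p : nat) (q t : R) (u v : 'cV[R]_p) :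
  1 <= q -> 0 <= t <= 1 -> lqnorm q u <= 1 -> lqnorm q v <= 1 ->
  lqnorm q (t *: u + (1 - t) *: v) <= 1.
Proof.
move=> q_ge1 /andP[t0 t1] u1 v1.
have q_gt0 : 0 < q by exact: lt_le_trans q_ge1.
have q_neq0 : q != 0 by rewrite gt_eqF.
have ball w : lqnorm q w <= 1 -> \sum_j `|w j 0| `^ q <= 1.
  move=> w1; rewrite -lqnorm_powR//.
  have <- : 1 `^ q = 1 :> R by rewrite powR1.
  by rewrite ge0_ler_powR ?nnegrE ?lqnorm_ge0// ltW.
apply: lqnorm_le => //; rewrite powR1.
apply: le_trans (_ : \sum_j (t * `|u j 0| `^ q + (1 - t) * `|v j 0| `^ q) <= _).
  apply: ler_sum => j _; rewrite !mxE.
  apply: le_trans (_ : (t * `|u j 0| + (1 - t) * `|v j 0|) `^ q <= _).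
    apply: ge0_ler_powR; first exact: ltW.
    - by rewrite nnegrE.
    - by rewrite nnegrE addr_ge0 ?mulr_ge0 ?subr_ge0.
    rewrite (le_trans (ler_normD _ _))// !normrM.
    by rewrite !(@ger0_norm _ (_ - _)) ?subr_ge0// ger0_norm.
  have := @convex_powR R q q_ge1 (Itv01 t0 t1) `|u j 0| `|v j 0|.
  by rewrite !convRE/=; apply; rewrite inE/= in_itv/= normr_ge0.
rewrite big_split/= -!mulr_sumr.
have t1' : 0 <= 1 - t by rewrite subr_ge0.
apply: le_trans (lerD (ler_wpM2l t0 (ball _ _ u1))
  (ler_wpM2l t1' (ball _ _ v1))) _.
by rewrite !mulr1 subrKC.
Qed.

(** [(u + v) / (a + b)] is the convex combination of [u / a] and [v / b] with
    weights [a / (a + b)] and [b / (a + b)]. *)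
Lemma lqnormD_le (R : realType) (p : nat) (q a b : R) (u v : 'cV[R]_p) :
  1 <= q -> 0 < a -> 0 < b -> lqnorm q u <= a -> lqnorm q v <= b ->
  lqnorm q (u + v) <= a + b.
Proof.
move=> q_ge1 a_gt0 b_gt0 ua vb.
have q_gt0 : 0 < q by exact: lt_le_trans q_ge1.
have [a_neq0 b_neq0] : a != 0 /\ b != 0 by rewrite !gt_eqF.
have ab_gt0 : 0 < a + b by rewrite addr_gt0.
have ab_neq0 : a + b != 0 by rewrite gt_eqF.
have -> : u + v = (a + b) *:
    ((a / (a + b)) *: (a^-1 *: u) + (1 - a / (a + b)) *: (b^-1 *: v)).
  rewrite (_ : 1 - a / (a + b) = b / (a + b)); last first.
    by apply: (mulIf ab_neq0); rewrite mulrBl !divfK// mul1r addrC addKr.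
  have cancel c : c != 0 -> (a + b) * (c / (a + b)) / c = 1.
    by move=> c_neq0; field; apply/andP.
  by rewrite scalerDr !scalerA !cancel// !scale1r.
rewrite lqnormZ// gtr0_norm// -[leRHS]mulr1 ler_pM2l//.
apply: lqnorm_convex => //.
- rewrite divr_ge0 ?(ltW a_gt0) ?(ltW ab_gt0)//= ler_pdivrMr//.
  by rewrite mul1r lerDl ltW.
- by rewrite lqnormZ// gtr0_norm ?invr_gt0// ler_pdivrMl// mulr1.
- by rewrite lqnormZ// gtr0_norm ?invr_gt0// ler_pdivrMl// mulr1.
Qed.

Lemma lqnormD (R : realType) (p : nat) (q : R) (u v : 'cV[R]_p) : 1 <= q ->
  lqnorm q (u + v) <= lqnorm q u + lqnorm q v.
Proof.
move=> q_ge1; have q_gt0 : 0 < q by exact: lt_le_trans q_ge1.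
have [/(lqnorm_eq0 q_gt0) ->|u_neq0] := eqVneq (lqnorm q u) 0.
  by rewrite add0r lerDr lqnorm_ge0.
have [/(lqnorm_eq0 q_gt0) ->|v_neq0] := eqVneq (lqnorm q v) 0.
  by rewrite addr0 lerDl lqnorm_ge0.
have u_gt0 : 0 < lqnorm q u by rewrite lt_neqAle eq_sym u_neq0 lqnorm_ge0.
have v_gt0 : 0 < lqnorm q v by rewrite lt_neqAle eq_sym v_neq0 lqnorm_ge0.
exact: lqnormD_le q_ge1 u_gt0 v_gt0 (lexx _) (lexx _).
Qed.

(** Bernoulli's inequality for real exponents: convexity of [exp] at the point
    [ln x], seen as the average of [q ln x] and [0] with weights [1 / q] and
    [1 - 1 / q]. *)
Lemma powR_bernoulli (R : realType) (q x : R) : 1 <= q -> 0 <= x ->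
  1 + q * (x - 1) <= x `^ q.
Proof.
move=> q_ge1; have q_gt0 : 0 < q by exact: lt_le_trans q_ge1.
have q_neq0 : q != 0 by rewrite gt_eqF.
rewrite le_eqVlt => /predU1P[<-|x_gt0]; first by rewrite powR0//; lra.
have t0 : 0 <= q^-1 by rewrite invr_ge0 ltW.
have t1 : q^-1 <= 1 by rewrite invf_le1.
have := convex_expR (Itv01 t0 t1) (q * ln x) 0.
rewrite !convRE/= /unstable.onem mulr0 addr0 mulKf// lnK ?posrE// expR0 mulr1.
rewrite /powR gt_eqF// -(ler_pM2l q_gt0) mulrDr mulVKf// mulrBr mulr1 mulfV//.
lra.
Qed.

(** The case of Hoelder's inequality where one factor is constant. Bernoulli's
    inequality is applied to the coordinates divided by their mean [mu]: the
    first-order terms sum to zero, leaving [p mu ^ q <= sum |v_j| ^ q]. *)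
Lemma sum_norm_le_lqnorm (R : realType) (p : nat) (q : R) (v : 'cV[R]_p) :
  1 <= q -> \sum_j `|v j 0| <= p%:R `^ (1 - q^-1) * lqnorm q v.
Proof.
move=> q_ge1; have q_gt0 : 0 < q by exact: lt_le_trans q_ge1.
have q_neq0 : q != 0 by rewrite gt_eqF.
case: p v => [|p] v.
  by rewrite big_ord0 mulr_ge0 ?powR_ge0 ?lqnorm_ge0.
have p_gt0 : 0 < p.+1%:R :> R by rewrite ltr0n.
set S := \sum_j _; set mu := S / p.+1%:R.
have S_ge0 : 0 <= S by exact: sumr_ge0.
have := S_ge0; rewrite le_eqVlt => /predU1P[<-|S_gt0].
  by rewrite mulr_ge0 ?powR_ge0 ?lqnorm_ge0.
have mu_gt0 : 0 < mu by rewrite divr_gt0.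
have mean : p.+1%:R * mu `^ q <= \sum_j `|v j 0| `^ q.
  have vE j : `|v j 0| `^ q = mu `^ q * (`|v j 0| / mu) `^ q.
    by rewrite -powRM ?divr_ge0 ?(ltW mu_gt0)// mulrC divfK// gt_eqF.
  under eq_bigr do rewrite vE.
  rewrite -mulr_sumr mulrC ler_pM2l ?powR_gt0//.
  apply: le_trans (ler_sum _ (fun j _ =>
    powR_bernoulli q_ge1 (divr_ge0 (normr_ge0 (v j 0)) (ltW mu_gt0)))).
  rewrite big_split/= -mulr_sumr sumrB -mulr_suml -/S !sumr_const card_ord.
  have -> : S / mu = p.+1%:R.
    by rewrite /mu invfM invrK mulrA mulfV ?gt_eqF// mul1r.
  by rewrite subrr mulr0 addr0.
have : (p.+1%:R * mu `^ q) `^ q^-1 <= lqnorm q v.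
  rewrite ge0_ler_powR ?nnegrE ?invr_ge0 ?(ltW q_gt0) ?mulr_ge0 ?powR_ge0//.
  by apply: sumr_ge0 => j _; exact: powR_ge0.
rewrite powRM ?powR_ge0// -powRrM mulfV// powRr1 ?(ltW mu_gt0)// => le1.
apply: le_trans (ler_wpM2l (powR_ge0 _ _) le1).
rewrite mulrA -powRD; last by rewrite pnatr_eq0 implybT.
by rewrite subrK powRr1// /mu mulrC divfK// gt_eqF.
Qed.

(** * Margins and edges *)

Lemma min_ord_le (R : realType) (n : nat) (F : 'I_n.+1 -> R) (i : 'I_n.+1) :
  min_ord F <= F i.
Proof. exact: bigmin_le. Qed.

Lemma lt_min_ord (R : realType) (n : nat) (F : 'I_n.+1 -> R) (c : R) :
  (forall i, c < F i) -> c < min_ord F.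
Proof. by move=> cF; apply/bigmin_gtP; split => // i _. Qed.

Lemma signed_data_margin (R : realType) (n p : nat) (y : 'I_n -> R)
    (X : 'M[R]_(n, p)) (theta : 'cV[R]_p) (i : 'I_n) :
  (signed_data y X *m theta) i 0 = y i * (X *m theta) i 0.
Proof.
by rewrite !mxE mulr_sumr; apply: eq_bigr => j _; rewrite mxE mulrA.
Qed.

Lemma inner_trmx (R : realType) (n p : nat) (Z : 'M[R]_(n, p))
    (eta : 'cV[R]_n) (u : 'cV[R]_p) :
  inner (Z^T *m eta) u = inner eta (Z *m u).
Proof.
rewrite /inner; under eq_bigr do rewrite mxE mulr_suml.
rewrite exchange_big/=; apply: eq_bigr => i _.
by rewrite mxE mulr_sumr; apply: eq_bigr => j _; rewrite mxE mulrCA mulrA.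
Qed.

Lemma margin_le_lqnorm (R : realType) (n p : nat) (q M : R)
    (Z : 'M[R]_(n, p)) (u : 'cV[R]_p) (i : 'I_n) :
  1 <= q -> (forall j, `|Z i j| <= M) ->
  `|(Z *m u) i 0| <= p%:R `^ (1 - q^-1) * M * lqnorm q u.
Proof.
move=> q_ge1; have q_gt0 : 0 < q by exact: lt_le_trans q_ge1.
case: p Z u => [|p] Z u ZM.
  by rewrite flatmx0 mulmx0 mxE normr0 lqnorm0// mulr0.
have M_ge0 : 0 <= M := le_trans (normr_ge0 _) (ZM 0).
rewrite mxE (mulrC (_ `^ _)) -mulrA.
apply: le_trans (ler_wpM2l M_ge0 (sum_norm_le_lqnorm u q_ge1)).
rewrite mulr_sumr; apply: le_trans (ler_norm_sum _ _ _) _.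
by apply: ler_sum => j _; rewrite normrM ler_wpM2r.
Qed.

(** [u] need only lie in the unit ball while [v] is optimal on the sphere, so
    [u] is compared after rescaling to norm one; this can only increase its
    edge, which is positive because it is at least [kappa]. *)
Lemma margin_le_edge (R : realType) (n p : nat) (q kappa : R)
    (Z : 'M[R]_(n, p)) (eta : 'cV[R]_n) (u v : 'cV[R]_p) :
  0 < q -> 0 < kappa -> (forall i, 0 <= eta i 0) -> \sum_i eta i 0 = 1 ->
  lqnorm q u <= 1 -> (forall i, kappa <= (Z *m u) i 0) ->
  argmax [set w : 'cV[R]_p | lqnorm q w = 1]%classic (inner (Z^T *m eta)) v ->
  kappa <= inner eta (Z *m v).
Proof.
move=> q_gt0 kappa_gt0 eta_ge0 eta_sum1 u_le1 kappa_le [_ v_max].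
have kappa_le_u : kappa <= inner eta (Z *m u).
  rewrite -[leLHS]mul1r -eta_sum1 mulr_suml.
  by apply: ler_sum => i _; rewrite ler_wpM2l.
have u_neq0 : lqnorm q u != 0.
  apply/eqP => /(lqnorm_eq0 q_gt0) u0; move: kappa_le_u.
  rewrite u0 mulmx0 /inner big1 => [|i _]; last by rewrite mxE mulr0.
  by rewrite leNgt kappa_gt0.
have u_gt0 : 0 < lqnorm q u by rewrite lt_neqAle eq_sym u_neq0 lqnorm_ge0.
have /v_max : lqnorm q ((lqnorm q u)^-1 *: u) = 1.
  by rewrite lqnormZ// gtr0_norm ?invr_gt0// mulVf.
rewrite !inner_trmx; apply: le_trans.
have -> : inner eta (Z *m ((lqnorm q u)^-1 *: u)) =
    (lqnorm q u)^-1 * inner eta (Z *m u).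
  rewrite /inner mulr_sumr; apply: eq_bigr => i _.
  by rewrite -scalemxAr mxE mulrCA.
rewrite ler_pdivlMl// (le_trans _ kappa_le_u)//.
by rewrite ler_piMl// ltW.
Qed.

(** Covers [q = 1] too, where [qstar] is infinite and both sides vanish. The
    values [0] and [-oo] of [qstar] would make the sum of inverses infinite. *)
Lemma conjugate_exponent (R : realType) (q : R) (qstar : \bar R) : 1 <= q ->
  ((q%:E)^-1 + qstar^-1 = 1)%E ->
  fine (2%:E / qstar)%E = 2 * (1 - q^-1).
Proof.
move=> q_ge1; have q_gt0 : 0 < q by exact: lt_le_trans q_ge1.
rewrite inver gt_eqF//; case: qstar => [r| |].
- rewrite inver; case: eqVneq => [//|r_neq0].
  by rewrite -EFinD -EFinM => -[<-] /=; rewrite addrAC subrr add0r.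
- by rewrite invey adde0 mule0 => -[->] /=; rewrite subrr mulr0.
- by rewrite inveNy.
Qed.

(** * The run of the algorithm *)

Definition edge (R : realType) (n p : nat) (Z : 'M[R]_(n, p))
    (eta : nat -> 'cV[R]_n) (v : nat -> 'cV[R]_p) (t : nat) : R :=
  inner (eta t) (Z *m v t.+1).

(** The last clause is the potential bound: along the run,
    [exp(- (Z theta_t)_i)] equals [n eta_t[i]] times the product of the
    normalization constants met so far, and Hoeffding's lemma bounds each of
    them. The edges stay positive because the weights stay in the simplex, so
    the step sizes are nonnegative, as Hoeffding's lemma and the norm bound
    require. *)
Lemma adaboost_invariant (R : realType) (n p : nat) (q beta L kappa : R)
    (Z : 'M[R]_(n.+1, p)) (T : nat) (eta : nat -> 'cV[R]_n.+1)
    (theta v : nat -> 'cV[R]_p) (u : 'cV[R]_p) :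
  1 <= q -> 0 <= beta -> 0 < L -> 0 < kappa ->
  (forall (w : 'cV[R]_p) i, `|(Z *m w) i 0| <= L * lqnorm q w) ->
  lqnorm q u <= 1 -> (forall i, kappa <= (Z *m u) i 0) ->
  adaboost_run q beta Z T eta theta v ->
  forall t, (t <= T)%N ->
  [/\ forall i, 0 <= eta t i 0, \sum_i eta t i 0 = 1,
      forall s, (s < t)%N -> kappa <= edge Z eta v s,
      lqnorm q (theta t) <= beta * \sum_(s < t) edge Z eta v s &
      forall i, expR (- (Z *m theta t) i 0) <= n.+1%:R * eta t i 0 *
        expR (- (beta * (1 - beta * L ^+ 2 / 2) *
                 \sum_(s < t) edge Z eta v s ^+ 2))].
Proof.
move=> q_ge1 beta_ge0 L_gt0 kappa_gt0 ZL u_le1 kappa_le run.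
have q_gt0 : 0 < q by exact: lt_le_trans q_ge1.
have n_neq0 : n.+1%:R != 0 :> R by rewrite pnatr_eq0.
elim=> [_|t IHt tT].
  rewrite (run_eta0 run) (run_theta0 run) !big_ord0 !mulr0 oppr0 lqnorm0//.
  split=> // [i||i].
  - by rewrite mxE invr_ge0.
  - under eq_bigr do rewrite mxE.
    by rewrite sumr_const card_ord -[_ *+ _]mulr_natr mulVf.
  - by rewrite mulmx0 !mxE oppr0 mulfV// mul1r.
have [eta_ge0 eta_sum1 edges norm_le exp_le] := IHt (ltnW tT).
have dir := run_direction run tT.
have v_norm1 : lqnorm q (v t.+1) = 1 by case: dir.
have g_ge : kappa <= edge Z eta v t.
  exact: margin_le_edge q_gt0 kappa_gt0 eta_ge0 eta_sum1 u_le1 kappa_le dir.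
set g := edge Z eta v t in g_ge *.
have g_gt0 : 0 < g := lt_le_trans kappa_gt0 g_ge.
set a := step_size beta Z (eta t) (v t.+1).
have aE : a = beta * g by [].
have a_ge0 : 0 <= a by rewrite aE mulr_ge0// ltW.
set w := fun i => eta t i 0 * expR (- a * (Z *m v t.+1) i 0).
have w_ge0 i : 0 <= w i by rewrite mulr_ge0 ?expR_ge0.
have etaE i : eta t.+1 i 0 = w i / \sum_j w j.
  by rewrite (run_eta run tT) mxE.
have w_sum_gt0 : 0 < \sum_j w j.
  (* The weights sum to 1, so one of them is positive. *)
  have [i i_gt0] : exists i, 0 < eta t i 0.
    apply/existsP; apply: contraPT eta_sum1 => /existsPn eta_le0.
    rewrite big1 => [/eqP|i _]; first by rewrite eq_sym oner_eq0.
    by apply/eqP; rewrite eq_le eta_ge0 leNgt eta_le0.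
  rewrite (bigD1 i)//= ltr_wpDr ?sumr_ge0//.
  by rewrite mulr_gt0 ?expR_gt0.
have w_sum_le : \sum_j w j <=
    expR (- (beta * (1 - beta * L ^+ 2 / 2) * g ^+ 2)).
  have xL i : `|(Z *m v t.+1) i 0| <= L.
    by rewrite (le_trans (ZL _ _))// v_norm1 mulr1.
  apply: le_trans (weighted_hoeffding eta_ge0 eta_sum1 L_gt0 xL a_ge0) _.
  rewrite [X in - a * X](_ : _ = g)// aE le_eqVlt; apply/orP; left; apply/eqP.
  by congr expR; field.
set c := beta * (1 - beta * L ^+ 2 / 2) in exp_le w_sum_le *.
split.
- by move=> i; rewrite etaE divr_ge0// ltW.
- under eq_bigr do rewrite etaE.
  by rewrite -mulr_suml mulfV// gt_eqF.
- by move=> s; rewrite ltnS leq_eqVlt => /predU1P[->//|/edges].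
- rewrite (run_theta run tT) -/a big_ord_recr/= -/g mulrDr -aE.
  apply: le_trans (lqnormD _ _ q_ge1) _; rewrite lerD//.
  by rewrite lqnormZ// v_norm1 mulr1 ger0_norm.
- move=> i; rewrite (run_theta run tT) -/a mulmxDr -scalemxAr !mxE.
  rewrite big_ord_recr/= -/g opprD expRD.
  rewrite [- (a * _)](_ : _ = - a * (Z *m v t.+1) i 0); last first.
    by rewrite mxE mulNr.
  have := exp_le i; rewrite {1}mxE => le1.
  apply: le_trans (ler_wpM2r (expR_ge0 _) le1) _.
  rewrite (mulrDr c) opprD expRD etaE.
  set B := expR (- (_ * \sum_(_ < t) _)); set C := expR _ in w_sum_le *.
  (* The unnormalized weight w i is the new weight times the normalizer. *)
  have -> : n.+1%:R * eta t i 0 * B * expR (- a * (Z *m v t.+1) i 0) =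
      n.+1%:R * B * (w i / \sum_j w j) * \sum_j w j.
    by rewrite -[RHS]mulrA divfK ?gt_eqF// /w; ring.
  rewrite [leRHS](_ : _ = n.+1%:R * B * (w i / \sum_j w j) * C); last by ring.
  by rewrite ler_wpM2l// !mulr_ge0 ?expR_ge0 ?invr_ge0// ltW.
Qed.

Theorem corollary3p2 (R : realType) (n p : nat) (q : R) (qstar : \bar R)
    (hq : 1 <= q) (hqstar : ((q%:E)^-1 + qstar^-1 = 1)%E)
    (X : 'M[R]_(n.+1, p)) (y : 'I_n.+1 -> R)
    (hy : forall i, y i = 1 \/ y i = -1)
    (M : R) (hM : forall i j, `|X i j| <= M)
    (kappa : R) (hkappa : is_lq_margin q y X kappa) (hkappa0 : 0 < kappa)
    (eps : R) (heps0 : 0 < eps) (heps1 : eps < 1)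
    (beta : R) (hbeta1 : beta < 1)
    (hbeta : beta = eps / (p%:R `^ fine (2%:E / qstar)%E * M ^+ 2))
    (T : nat) (eta : nat -> 'cV[R]_n.+1) (theta v : nat -> 'cV[R]_p)
    (hrun : adaboost_run q beta (signed_data y X) T eta theta v)
    (hT : ln (101%:R / 100%:R * n.+1%:R * expR 1) *
          (2 * p%:R `^ fine (2%:E / qstar)%E * M ^+ 2 * eps ^- 2 / kappa ^+ 2)
          <= T%:R) :
  let m := min_ord (fun i => y i * (X *m theta T) i 0 / lqnorm q (theta T)) in
  m <= kappa /\ kappa * (1 - eps) < m.
Proof.
have q_gt0 : 0 < q by exact: lt_le_trans hq.
case: hkappa => u [u_le1 u_max] kappaE; move: u_max; rewrite -kappaE => u_max.
set Z := signed_data y X in hrun.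
have kappa_le i : kappa <= (Z *m u) i 0.
  by rewrite kappaE signed_data_margin min_ord_le.
pose L := p%:R `^ (1 - q^-1) * M.
have ZL w i : `|(Z *m w) i 0| <= L * lqnorm q w.
  apply: margin_le_lqnorm => // j; rewrite mxE normrM.
  by case: (hy i) => ->; rewrite ?normrN normr1 mul1r.
(* Positivity of L comes from that of kappa, for p and M carry no sign
   assumption. *)
have L_ge : kappa <= L * lqnorm q u.
  by rewrite (le_trans (kappa_le ord0))// (le_trans (ler_norm _)).
have L_gt0 : 0 < L.
  rewrite ltNge; apply/negP => L_le0; move: L_ge; apply/negP.
  by rewrite -ltNge (le_lt_trans _ hkappa0)// mulr_le0_ge0 ?lqnorm_ge0.
have LE : p%:R `^ fine (2%:E / qstar)%E * M ^+ 2 = L ^+ 2.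
  rewrite (conjugate_exponent hq hqstar) exprMn; congr (_ * _).
  by rewrite mulrC powRrM powR_mulrn// powR_ge0.
rewrite LE in hbeta; rewrite -(mulrA 2) LE in hT.
have L_neq0 : L != 0 by rewrite gt_eqF.
have beta_gt0 : 0 < beta by rewrite hbeta divr_gt0// exprn_gt0.
have [eta_ge0 eta_sum1 edges norm_le exp_le] :=
  adaboost_invariant hq (ltW beta_gt0) L_gt0 hkappa0 ZL u_le1 kappa_le hrun
    (leqnn T).
set N := lqnorm q (theta T) in norm_le *.
have N_ge0 : 0 <= N := lqnorm_ge0 _ _.
set G := \sum_(s < T) edge Z eta v s in norm_le.
set G2 := \sum_(s < T) edge Z eta v s ^+ 2 in exp_le.
have G_ge : T%:R * kappa <= G.
  rewrite mulr_natl -[T in kappa *+ T]card_ord -sumr_const.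
  by apply: ler_sum => s _; exact: edges.
have G2_ge : kappa * G <= G2.
  rewrite mulr_sumr; apply: ler_sum => s _.
  have g_ge := edges s (ltn_ord s).
  by rewrite expr2 ler_wpM2r// (le_trans (ltW hkappa0)).
have betaL : beta * L ^+ 2 = eps by rewrite hbeta divfK// expf_neq0.
rewrite betaL in exp_le.
have margin_ge i : beta * (1 - eps / 2) * G2 - ln n.+1%:R <= (Z *m theta T) i 0.
  have : expR (- (Z *m theta T) i 0) <=
      n.+1%:R * expR (- (beta * (1 - eps / 2) * G2)).
    apply: le_trans (exp_le i) _; rewrite ler_wpM2r ?expR_ge0//.
    rewrite ler_piMr// -eta_sum1 (bigD1 i)//= lerDl sumr_ge0//.
  rewrite -ler_ln ?posrE ?mulr_gt0 ?expR_gt0// lnM ?posrE ?expR_gt0//.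
  by rewrite !expRK; lra.
have steps : ln (n.+1%:R : R) < beta * kappa * (T%:R * kappa) * (eps / 2).
  have n_gt0 : 0 < n.+1%:R :> R by rewrite ltr0n.
  have -> : beta * kappa * (T%:R * kappa) * (eps / 2) =
      T%:R / (2 * L ^+ 2 * eps ^- 2 / kappa ^+ 2).
    by rewrite hbeta; field; rewrite L_neq0 !gt_eqF.
  have c_gt0 : 0 < 2 * L ^+ 2 * eps ^- 2 / kappa ^+ 2.
    apply: divr_gt0; last exact: exprn_gt0.
    by apply: divr_gt0; [apply: mulr_gt0 => //|]; exact: exprn_gt0.
  move: hT; rewrite -ler_pdivlMr//; apply: lt_le_trans.
  have c0_gt0 : 0 < 101 / 100 * n.+1%:R * expR 1 :> R.
    by apply: mulr_gt0 (expR_gt0 _); apply: mulr_gt0 => //; apply: divr_gt0.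
  rewrite ltr_ln ?posrE//.
  (* e >= 2 makes 1.01 n e exceed n. *)
  have e_ge : 1 + 1 <= expR 1 :> R := expR_ge1Dx 1.
  have : n.+1%:R * 2 <= n.+1%:R * expR 1 :> R by rewrite ler_pM2l.
  by nra.
have margin_gt i : kappa * (1 - eps) * N < (Z *m theta T) i 0.
  apply: lt_le_trans (margin_ge i).
  (* The three estimates combine linearly with steps. *)
  have h1 : kappa * (1 - eps) * N <= kappa * (1 - eps) * (beta * G).
    by rewrite ler_wpM2l// mulr_ge0 ?(ltW hkappa0)//; lra.
  have h2 : beta * (1 - eps / 2) * (kappa * G) <= beta * (1 - eps / 2) * G2.
    by rewrite ler_wpM2l// mulr_ge0 ?(ltW beta_gt0)//; lra.
  have h3 : beta * kappa * (eps / 2) * (T%:R * kappa) <=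
      beta * kappa * (eps / 2) * G.
    by rewrite ler_wpM2l// !mulr_ge0 ?(ltW beta_gt0) ?(ltW hkappa0)//; lra.
  lra.
have N_neq0 : N != 0.
  apply/eqP => N0; have := margin_gt ord0.
  by rewrite (lqnorm_eq0 q_gt0 N0) mulmx0 mxE N0 mulr0 ltxx.
have N_gt0 : 0 < N by rewrite lt_neqAle eq_sym N_neq0.
split.
- have /u_max : lqnorm q (N^-1 *: theta T) <= 1.
    by rewrite lqnormZ// gtr0_norm ?invr_gt0// mulVf.
  apply: le_trans; rewrite le_eqVlt; apply/orP; left; apply/eqP.
  congr min_ord; apply/funext => i.
  by rewrite -scalemxAr [in RHS]mxE mulrCA mulrC.
- apply: lt_min_ord => i.
  by rewrite ltr_pdivlMr// -signed_data_margin.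
Qed.
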